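(* Let $\gamma>1$ and let $U_0=(q_0,\rho_0,p_0)$ be a uniform supersonic state with positive components, i.e. $M_0:=\sqrt{\rho_0q_0^2/(\gamma p_0)}>1$, and let $U_1=(q_1,\rho_1,p_1)$ be the unique subsonic state connected to $U_0$ by the Rankine–Hugoniot conditions (see context). Suppose that one of the following two conditions holds: (S1) $1<\gamma<3$ and $1<M_0^2\le \dfrac{3\gamma-1}{\gamma(3-\gamma)}$; (S2) $\gamma\ge 3$ and $M_0>1$. Set $p_*:=\frac{p_0+p_1}{2}$ and $A:=\rho_0q_0^2+p_0$. Consider, for $\epsilon>0$ and an exit pressure $p_e$, the boundary value problem on $[0,1]$ for $U=(u,\rho,p)$: $$\partial_x(\rho u)=0,\qquad \partial_x(\rho u^2+p)=0,\qquad \partial_x\Big(\rho u\,\Phi\Big)=\epsilon\,\partial_{xx}e,$$ $$U(0)=U_0,\qquad p(1)=p_e .$$ Then for any $\epsilon>0$: 1. if $p_e\in(0,p_0)\cup(p_0,p_* )$, there exists a supersonic solution $U=U^\epsilon(x)\in C^2([0,1])$ of this boundary value problem; 2. if $p_e\in(p_*,p_1)\cup(p_1,\frac A2)$, the boundary value problem admits a transonic solution $U=U^\epsilon(x)\in C^2([0,1])$.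
   Context: Here $u,\rho,p$ are the velocity, density and pressure of a polytropic gas with adiabatic exponent $\gamma>1$. The internal energy is $e=\frac{1}{\gamma-1}\frac{p}{\rho}$, and $\Phi=\frac12u^2+\frac{\gamma}{\gamma-1}\frac p\rho$ is the Bernoulli function. The constant $\epsilon$ is the heat conductivity coefficient. The sound speed is $c=\sqrt{\gamma p/\rho}$ and the Mach number is $M=|u|/c$; the flow is supersonic where $M>1$ and subsonic where $M<1$. The state $U_1=(q_1,\rho_1,p_1)$ is the unique subsonic state satisfying the Rankine–Hugoniot conditions $\rho_0q_0=\rho_1q_1$, $\rho_0q_0^2+p_0=\rho_1q_1^2+p_1$, $\Phi_0=\Phi_1$, where $\Phi_i=\frac12q_i^2+\frac{\gamma}{\gamma-1}\frac{p_i}{\rho_i}$; one has $p_1>p_0$. A solution is called supersonic if $M>1$ on all of $[0,1]$. It is called transonic (supersonic–subsonic) if there is a point $\hat x\in(0,1)$ such that the flow is supersonic for $x<\hat x$ and subsonic for $x>\hat x$. *)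

(* Defs.v *)
From Stdlib Require Export Reals.
Open Scope R_scope.

Record state := State { vel : R; dens : R; pres : R }.

Definition gas_state (U : state) : Prop := 0 < dens U /\ 0 < pres U.

Definition internal_energy (gamma : R) (U : state) : R :=
  / (gamma - 1) * (pres U / dens U).

Definition bernoulli (gamma : R) (U : state) : R :=
  / 2 * vel U ^ 2 + gamma / (gamma - 1) * (pres U / dens U).

Definition sound_speed (gamma : R) (U : state) : R :=
  sqrt (gamma * pres U / dens U).

Definition mach (gamma : R) (U : state) : R :=
  Rabs (vel U) / sound_speed gamma U.

Definition rankine_hugoniot (gamma : R) (U0 U1 : state) : Prop :=
  dens U0 * vel U0 = dens U1 * vel U1 /\
  dens U0 * vel U0 ^ 2 + pres U0 = dens U1 * vel U1 ^ 2 + pres U1 /\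
  bernoulli gamma U0 = bernoulli gamma U1.

Definition I01 (x : R) : Prop := 0 <= x <= 1.

(* [D_in f d D x] is the derivative relative to [D]; on [I01] it is one-sided
   at the endpoints 0 and 1, and two-sided in the interior. *)
Definition has_derivative (f f1 : R -> R) : Prop :=
  forall x, I01 x -> D_in f f1 I01 x.

Definition has_second_derivative (f f2 : R -> R) : Prop :=
  exists f1, has_derivative f f1 /\ has_derivative f1 f2.

Definition C2_01 (f : R -> R) : Prop :=
  exists f2, has_second_derivative f f2 /\
             forall x, I01 x -> continue_in f2 I01 x.

Definition C2_state (U : R -> state) : Prop :=
  C2_01 (fun x => vel (U x)) /\
  C2_01 (fun x => dens (U x)) /\
  C2_01 (fun x => pres (U x)).

Definition mass_eq (U : R -> state) : Prop :=
  has_derivative (fun x => dens (U x) * vel (U x)) (fun _ => 0).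

Definition momentum_eq (U : R -> state) : Prop :=
  has_derivative (fun x => dens (U x) * vel (U x) ^ 2 + pres (U x))
                 (fun _ => 0).

Definition energy_eq (gamma eps : R) (U : R -> state) : Prop :=
  exists exx,
    has_second_derivative (fun x => internal_energy gamma (U x)) exx /\
    has_derivative (fun x => dens (U x) * vel (U x) * bernoulli gamma (U x))
                   (fun x => eps * exx x).

(* Vacuum is excluded: density and pressure are positive, so that the internal
   energy, the sound speed and the Mach number make sense. *)
Definition bvp_solution (gamma eps : R) (U0 : state) (pe : R)
    (U : R -> state) : Prop :=
  (forall x, I01 x -> gas_state (U x)) /\
  C2_state U /\
  mass_eq U /\ momentum_eq U /\ energy_eq gamma eps U /\
  U 0 = U0 /\ pres (U 1) = pe.

Definition supersonic (gamma : R) (U : R -> state) : Prop :=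
  forall x, I01 x -> 1 < mach gamma (U x).

Definition transonic (gamma : R) (U : R -> state) : Prop :=
  exists xh, 0 < xh < 1 /\
    forall x, I01 x ->
      (x < xh -> 1 < mach gamma (U x)) /\ (xh < x -> mach gamma (U x) < 1).

(* Main.v *)
Require Import Defs.
From Stdlib Require Import Reals Lra Ranalysis5.
From Coquelicot Require Import Coquelicot.
Open Scope R_scope.

(** Write [m] for the mass flux [rho u] and [A] for the momentum flux
[rho u ^ 2 + p], both constant along a solution.  The pressure then
determines the whole state, [u = (A - p) / m] and [rho = m ^ 2 / (A - p)],
and the energy equation, integrated once, is a scalar first-order equation
[eps e' = m (Phi - C)] with a free constant [C].  The Bernoulli function is
a concave quadratic in [p] with its vertex at the sonic pressure
[c = A / (gamma + 1)], so the equation reads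
  [(A - 2 p) p' = a (B - (p - c) ^ 2)],  [a = (gamma + 1) m / (2 eps)],
with [B] free.  The state is supersonic for [p < c] and subsonic for [p > c].
Since [p0] and [p1] give the same Bernoulli value, the parabola is symmetric
about their mean, hence [c = (p0 + p1) / 2].

To join [p0] to [pe] below [A / 2] it remains to choose [B] so that the
monotone solution takes exactly unit time, i.e. so that the integral from
[p0] to [pe] of [(A - 2 p) / (a (B - (p - c) ^ 2))] is 1.  Moving [B] from
infinity (with the sign of [pe - p0]) to the value at which the denominator
first vanishes, the travel time moves continuously from 0 to infinity.  The
zero is reached at an end point of the pressure interval, and the denominator
is Lipschitz, so the divergence is at least logarithmic
([exists_unit_integral]).  The profile is the inverse of the travel-time
function ([unit_time_flow], [exists_pressure_profile]), and differentiating
along the scalar equation gives the system back ([profile_bvp_solution]).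

A decreasing profile, or one that stops below [c], remains supersonic; an
increasing one that ends above [c] crosses [c] exactly once.  The conditions
on the exponent and the Mach number amount to [p1 <= A / 2], which keeps all
the exit pressures considered below [A / 2]. *)

(** * Flows on the line with prescribed travel time *)

(** The lower bound on the derivative makes [T] onto the line and its inverse
Lipschitz; by the mean value theorem a difference quotient of the inverse is
[/ K xi] for some intermediate [xi], and the Lipschitz bound forces [xi] to
the base point. *)
Lemma is_derive_inverse (T K : R -> R) (c : R) :
  0 < c -> (forall x, c <= K x) -> (forall x, continuity_pt K x) ->
  (forall x, is_derive T x (K x)) ->
  exists S : R -> R,
    (forall x, T (S x) = x) /\ (forall x, is_derive S x (/ K (S x))).
Proof.
intros c0 Kc Kcont dT.
assert (mv : forall u v, exists xi,
  Rmin u v <= xi <= Rmax u v /\ T v - T u = K xi * (v - u)).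
{ intros u v; apply MVT_gen.
  - intros x _; apply dT.
  - intros x _; apply derivable_continuous_pt; exists (K x).
    apply is_derive_Reals, dT. }
assert (grow : forall u v, u <= v -> c * (v - u) <= T v - T u).
{ intros u v uv; destruct (mv u v) as [xi [_ ->]].
  apply Rmult_le_compat_r; [lra | apply Kc]. }
(* [T] grows at least linearly, so it takes the value [x] within distance
   |x - T 0| / c of the origin *)
assert (surj : forall x, {y | T y = x}).
{ intros x; set (r := Rabs (x - T 0) / c).
  assert (r0 : 0 <= r).
  { apply Rmult_le_pos; [apply Rabs_pos | left; now apply Rinv_0_lt_compat]. }
  assert (cr : c * r = Rabs (x - T 0)) by (unfold r; field; lra).
  pose proof (grow (- r) 0) as lo; pose proof (grow 0 r) as hi.
  pose proof (Rle_abs (x - T 0)); pose proof (Rle_abs (- (x - T 0))) as opp.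
  rewrite Rabs_Ropp in opp.
  destruct (IVT_gen T (- r) r x) as [y [_ Ty]].
  - intros z; apply derivable_continuous_pt; exists (K z).
    apply is_derive_Reals, dT.
  - rewrite Rmin_left, Rmax_right by lra; lra.
  - now exists y. }
assert (inv : exists S, forall x, T (S x) = x)
  by (exists (fun x => proj1_sig (surj x)); intros x; exact (proj2_sig (surj x))).
destruct inv as [S TS]; exists S; split; [exact TS|]; intros x.
apply is_derive_Reals; intros e e0.
assert (Kx : K (S x) <> 0) by (pose proof (Kc (S x)); lra).
destruct (continuity_pt_inv K (S x) (Kcont _) Kx e e0) as [d [d0 Hd]].
assert (cd : 0 < c * d) by now apply Rmult_lt_0_compat.
exists (mkposreal _ cd); intros h h0 hd; simpl in hd.
destruct (mv (S x) (S (x + h))) as [xi [xib E]].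
rewrite !TS in E.
pose proof (Kc xi) as Kxi.
assert (D : S (x + h) - S x = h / K xi).
{ apply (Rmult_eq_reg_l (K xi)); [|lra]; rewrite <- E; field; lra. }
assert (hK : Rabs (h / K xi) < d).
{ unfold Rdiv; rewrite Rabs_mult, Rabs_inv, (Rabs_pos_eq (K xi)) by lra.
  apply (Rmult_lt_reg_r (K xi)); [lra|].
  rewrite Rmult_assoc, Rinv_l, Rmult_1_r by lra.
  apply (Rlt_le_trans _ _ _ hd); rewrite Rmult_comm.
  apply Rmult_le_compat_l; lra. }
rewrite D; replace (h / K xi / h) with (/ K xi) by (field; lra).
destruct (Req_dec xi (S x)) as [->|ne].
{ rewrite Rminus_diag, Rabs_R0; exact e0. }
apply (Hd xi); split; [now split; [|apply not_eq_sym]|].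
simpl; unfold Rdist.
rewrite <- D in hK; revert xib hK; unfold Rmin, Rmax, Rabs.
repeat destruct Rcase_abs; repeat destruct Rle_dec; lra.
Qed.

(** Composing with this retraction turns a rate given on [[0, 1]] into one on
the whole line, so that the travel time and its inverse have two-sided
derivatives even at the end points. *)
Definition unit_clamp (x : R) : R := Rmax 0 (Rmin 1 x).

Lemma unit_clamp_bounds x : 0 <= unit_clamp x <= 1.
Proof.
unfold unit_clamp, Rmax, Rmin; repeat destruct Rle_dec; lra.
Qed.

Lemma unit_clamp_id x : 0 <= x <= 1 -> unit_clamp x = x.
Proof.
unfold unit_clamp, Rmax, Rmin; repeat destruct Rle_dec; lra.
Qed.

Lemma continuity_pt_unit_clamp x : continuity_pt unit_clamp x.
Proof.
intros e e0; exists e; split; [exact e0|]; intros y [_ yx]; revert yx.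
simpl; unfold Rdist, unit_clamp, Rmax, Rmin, Rabs.
repeat destruct Rcase_abs; repeat destruct Rle_dec; lra.
Qed.

(** [k] is the time spent per unit of length, so [S] is the flow of the
autonomous equation [S' = / k S]: it inverts the primitive of [k], whose
total increase on [[0, 1]] is the travel time 1. *)
Lemma unit_time_flow (k : R -> R) :
  (forall s, 0 <= s <= 1 -> continuity_pt k s) ->
  (forall s, 0 <= s <= 1 -> 0 < k s) ->
  RInt k 0 1 = 1 ->
  exists S : R -> R,
    S 0 = 0 /\ S 1 = 1 /\ (forall x y, x < y -> S x < S y) /\
    (forall x, 0 <= x <= 1 -> is_derive S x (/ k (S x))).
Proof.
intros kcont kpos kint.
destruct (continuity_ab_min k 0 1) as [m [kmin mb]]; [lra | exact kcont |].
set (K := fun x => k (unit_clamp x)).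
assert (Kcont : forall x, continuity_pt K x).
{ intros x; apply continuity_pt_comp with (f2 := k).
  - apply continuity_pt_unit_clamp.
  - apply kcont, unit_clamp_bounds. }
assert (Kex : forall a b, ex_RInt K a b).
{ intros a b; apply (ex_RInt_continuous (V := R_CompleteNormedModule)).
  intros z _; apply continuity_pt_filterlim, Kcont. }
set (T := fun x => RInt K 0 x).
assert (dT : forall x, is_derive T x (K x)).
{ intros x; apply (is_derive_RInt (V := R_NormedModule)) with (a := 0).
  - apply filter_forall; intros y.
    apply (RInt_correct (V := R_CompleteNormedModule)), Kex.
  - apply continuity_pt_filterlim, Kcont. }
destruct (is_derive_inverse T K (k m)) as [S [TS dS]]; try assumption.
{ now apply kpos. }
{ intros x; apply kmin, unit_clamp_bounds. }
assert (Tinc : forall x y, x < y -> T x < T y).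
{ intros x y xy; destruct (MVT_gen T x y K) as [xi [_ E]].
  - intros z _; apply dT.
  - intros z _; apply derivable_continuous_pt; exists (K z).
    apply is_derive_Reals, dT.
  - assert (0 < K xi) by apply kpos, unit_clamp_bounds.
    assert (0 < K xi * (y - x)) by (apply Rmult_lt_0_compat; lra); lra. }
assert (Sinc : forall x y, x < y -> S x < S y).
{ intros x y xy; destruct (Rlt_le_dec (S x) (S y)) as [|[lt|eq]]; trivial.
  - apply Tinc in lt; rewrite !TS in lt; lra.
  - rewrite <- (TS x), <- (TS y), eq in xy; lra. }
assert (Tinj : forall x y, T x = T y -> x = y).
{ intros x y E; destruct (Rtotal_order x y) as [l|[->|l]]; trivial;
  apply Tinc in l; lra. }
assert (S0 : S 0 = 0).
{ apply Tinj; rewrite TS; unfold T; now rewrite RInt_point. }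
assert (S1 : S 1 = 1).
{ apply Tinj; rewrite TS; unfold T; symmetry; transitivity (RInt k 0 1);
    [|exact kint]; apply RInt_ext.
  rewrite Rmin_left, Rmax_right by lra.
  intros x xb; unfold K; rewrite unit_clamp_id; lra. }
exists S; refine (conj S0 (conj S1 (conj Sinc _))).
intros x xb; rewrite <- (unit_clamp_id (S x)); [apply dS|].
destruct xb as [[xl| <-] [xr| ->]]; try lra.
apply Sinc in xl, xr; lra.
Qed.

(** By the intermediate value theorem in [mu].  The integral is at most
[M / mu] for an upper bound [M] of [w], hence small for large [mu]; at small
[mu] the upper bound on [psi] and a lower bound [m > 0] of [w] make it at
least the integral of [m / (mu + L |s - s0|)], which diverges logarithmically as [mu] tends
to 0. *)
Lemma exists_unit_integral (w psi : R -> R) (s0 L : R) :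
  (forall s, 0 <= s <= 1 -> continuity_pt w s) ->
  (forall s, 0 <= s <= 1 -> 0 < w s) ->
  (forall s, 0 <= s <= 1 -> continuity_pt psi s) ->
  s0 = 0 \/ s0 = 1 -> 0 < L ->
  (forall s, 0 <= s <= 1 -> 0 <= psi s <= L * Rabs (s - s0)) ->
  exists mu, 0 < mu /\ RInt (fun s => w s / (mu + psi s)) 0 1 = 1.
Proof.
intros wcont wpos pcont s01 L0 psib.
destruct (continuity_ab_min w 0 1) as [m [wmin mb]]; [lra | exact wcont |].
destruct (continuity_ab_maj w 0 1) as [M [wmax Mb]]; [lra | exact wcont |].
specialize (wpos m mb) as wm0.
specialize (wpos M Mb) as wM0.
revert wmin wmax wm0 wM0; generalize (w m) (w M); clear m mb M Mb.
intros m M wmin wmax m0 M0.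
assert (cont : forall mu, 0 < mu -> forall s, 0 <= s <= 1 ->
  continuity_pt (fun s => w s / (mu + psi s)) s).
{ intros mu mu0 s sb; apply continuity_pt_div; [now apply wcont| |].
  - apply continuity_pt_plus; [|now apply pcont].
    apply continuity_pt_const; now intros ? ?.
  - pose proof (psib s sb); lra. }
assert (int : forall mu, 0 < mu -> ex_RInt (fun s => w s / (mu + psi s)) 0 1).
{ intros mu mu0; apply (ex_RInt_continuous (V := R_CompleteNormedModule)).
  rewrite Rmin_left, Rmax_right by lra; intros s sb.
  now apply continuity_pt_filterlim, cont. }
set (I := fun mu => RInt (fun s => w s / (mu + psi s)) 0 1).
assert (upper : forall mu, 0 < mu -> I mu <= M / mu).
{ intros mu mu0.
  replace (M / mu) with (RInt (fun _ => M / mu) 0 1)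
    by (rewrite RInt_const; unfold scal; simpl; unfold mult; simpl; ring).
  apply RInt_le; [lra | now apply int | apply ex_RInt_const |].
  intros s sb; assert (sb' : 0 <= s <= 1) by lra.
  pose proof (psib s sb'); pose proof (wmax s sb').
  apply Rmult_le_compat; try lra.
  - left; now apply wpos.
  - left; apply Rinv_0_lt_compat; lra.
  - apply Rinv_le_contravar; lra. }
set (d := L * exp (- (2 * L / m))).
assert (d0 : 0 < d) by (apply Rmult_lt_0_compat; [lra | apply exp_pos]).
(* the primitive of m / (d + L * |s - s0|) grows by at least
   (m / L) * ln (L / d) = 2 over the unit interval *)
assert (lower : 2 <= I d).
{ set (g := 1 - 2 * s0).
  assert (g2 : g * g = 1) by (destruct s01 as [-> | ->]; unfold g; ring).
  assert (abs : forall s, 0 <= s <= 1 -> Rabs (s - s0) = s0 + g * s).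
  { intros s sb; unfold g; destruct s01 as [-> | ->].
    - rewrite Rabs_pos_eq; lra.
    - rewrite Rabs_left1; lra. }
  assert (den : forall s, 0 <= s <= 1 -> d <= d + L * (s0 + g * s)).
  { intros s sb; rewrite <- abs by exact sb.
    pose proof (Rmult_le_pos L (Rabs (s - s0)) (Rlt_le _ _ L0) (Rabs_pos _)).
    lra. }
  assert (P : is_RInt (fun s => m / (d + L * (s0 + g * s))) 0 1
    (minus (m / L * g * ln (d + L * (s0 + g * 1)))
           (m / L * g * ln (d + L * (s0 + g * 0))))).
  { apply (is_RInt_derive (V := R_CompleteNormedModule)
      (fun s => m / L * g * ln (d + L * (s0 + g * s))));
    rewrite Rmin_left, Rmax_right by lra; intros s sb;
    pose proof (den s sb).
    - auto_derive; [lra|].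
      transitivity (g * g * m / (d + L * (s0 + g * s))).
      + field; lra.
      + rewrite g2; field; lra.
    - apply (ex_derive_continuous (fun s => m / (d + L * (s0 + g * s)))).
      auto_derive; lra. }
  assert (ln2 : 2 <= m / L * (ln (d + L) - ln d)).
  { assert (ln L <= ln (d + L)) by (apply ln_le; lra).
    assert (E : ln d = ln L - 2 * L / m).
    { unfold d; rewrite ln_mult, ln_exp by (trivial; apply exp_pos); ring. }
    replace 2 with (m / L * (2 * L / m)) by (field; lra).
    apply Rmult_le_compat_l; [|lra].
    left; apply Rmult_lt_0_compat; [lra | now apply Rinv_0_lt_compat]. }
  apply Rle_trans with (RInt (fun s => m / (d + L * (s0 + g * s))) 0 1).
  - rewrite (is_RInt_unique _ _ _ _ P).
    apply (Rle_trans _ _ _ ln2), Req_le.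
    unfold minus, plus, opp; simpl; unfold g; destruct s01 as [-> | ->].
    + replace (d + L * (0 + (1 - 2 * 0) * 1)) with (d + L) by ring.
      replace (d + L * (0 + (1 - 2 * 0) * 0)) with d by ring. ring.
    + replace (d + L * (1 + (1 - 2 * 1) * 1)) with d by ring.
      replace (d + L * (1 + (1 - 2 * 1) * 0)) with (d + L) by ring. ring.
  - apply RInt_le; [lra | eexists; exact P | now apply int |].
    intros s sb; assert (sb' : 0 <= s <= 1) by lra.
    pose proof (psib s sb') as pb; rewrite (abs s sb') in pb.
    pose proof (wmin s sb').
    apply Rmult_le_compat; try lra.
    + left; apply Rinv_0_lt_compat; lra.
    + apply Rinv_le_contravar; lra. }
(* truncating at [d] makes the integral a Lipschitz function of [mu] on the
   whole line, since the denominators stay above [d] *)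
set (F := fun mu => I (Rmax d mu)).
assert (Fcont : continuity F).
{ assert (lip : forall x y, Rabs (F y - F x) <= M / (d * d) * Rabs (y - x)).
  { intros x y; unfold F, I.
    set (x' := Rmax d x); set (y' := Rmax d y).
    assert (dx : d <= x') by apply Rmax_l.
    assert (dy : d <= y') by apply Rmax_l.
    assert (xy : Rabs (y' - x') <= Rabs (y - x)).
    { unfold x', y', Rmax, Rabs.
      repeat destruct Rle_dec; repeat destruct Rcase_abs; lra. }
    rewrite <- (RInt_minus (V := R_CompleteNormedModule)) by (apply int; lra).
    eapply Rle_trans; [apply abs_RInt_le_const with
      (M := M / (d * d) * Rabs (y - x))|lra]; [lra | |].
    - apply @ex_RInt_minus; apply int; lra.
    - intros s sb; unfold minus, plus, opp; simpl.
      pose proof (psib s sb); pose proof (wmax s sb); pose proof (wpos s sb).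
      replace (w s / (y' + psi s) + - (w s / (x' + psi s))) with
        (w s * / ((x' + psi s) * (y' + psi s)) * (x' - y')) by (field; lra).
      rewrite Rabs_mult, Rabs_minus_sym.
      assert (dd : 0 < d * d) by now apply Rmult_lt_0_compat.
      assert (le : d * d <= (x' + psi s) * (y' + psi s))
        by (apply Rmult_le_compat; lra).
      assert (0 < / ((x' + psi s) * (y' + psi s)))
        by (apply Rinv_0_lt_compat; lra).
      rewrite Rabs_pos_eq by (apply Rmult_le_pos; lra).
      apply Rmult_le_compat; trivial using Rabs_pos.
      + apply Rmult_le_pos; lra.
      + apply Rmult_le_compat; try lra.
        now apply Rinv_le_contravar. }
  set (C := M / (d * d)).
  assert (C0 : 0 < C).
  { apply Rmult_lt_0_compat; [lra|].
    apply Rinv_0_lt_compat; now apply Rmult_lt_0_compat. }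
  intros x e e0; exists (e / C); split; [now apply Rdiv_lt_0_compat|].
  intros y [_ yx]; simpl in *; unfold Rdist in *.
  apply (Rle_lt_trans _ _ _ (lip x y)); fold C.
  apply (Rmult_lt_compat_l C) in yx; [|exact C0].
  now replace (C * (e / C)) with e in yx by (field; lra). }
assert (Md : d <= M / 2).
{ pose proof (upper d d0) as ud.
  assert (le : 2 <= M / d) by lra.
  apply (Rmult_le_compat_r d) in le; [|lra].
  replace (M / d * d) with M in le by (field; lra); lra. }
destruct (IVT_gen F d (2 * M) 1 Fcont) as [mu [_ Fmu]].
{ assert (F d = I d) as -> by (unfold F; now rewrite Rmax_left by lra).
  assert (F (2 * M) = I (2 * M)) as ->
    by (unfold F; now rewrite Rmax_right by lra).
  pose proof (upper (2 * M)) as up.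
  replace (M / (2 * M)) with (/ 2) in up by (field; lra).
  rewrite Rmin_right, Rmax_left by lra; lra. }
exists (Rmax d mu); split; [pose proof (Rmax_l d mu); lra | exact Fmu].
Qed.

(** * The pressure equation *)

(** The profile is sought as [p0 + (pe - p0) S x], with [S] a flow from 0 to
1 on the unit interval; this treats increasing and decreasing profiles
alike.  The travel time diverges as [B] tends to the maximum of
[(p - c) ^ 2] when the pressure increases, to its minimum when it decreases.
The maximum of a convex function lies at an end point; the minimum lies at
[p0] because of [p0 <= c]. *)
Lemma exists_pressure_profile (A a c p0 pe : R) :
  0 < a -> 2 * p0 < A -> 2 * pe < A -> p0 < pe \/ pe < p0 <= c ->
  exists (B : R) (p : R -> R),
    p 0 = p0 /\ p 1 = pe /\
    (forall x y, x < y -> 0 < (pe - p0) * (p y - p x)) /\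
    (forall x, 0 <= x <= 1 ->
       is_derive p x (a * (B - (p x - c) ^ 2) / (A - 2 * p x))).
Proof.
intros a0 Ap0 Ape dir.
set (d := pe - p0); set (P := fun s => p0 + d * s).
assert (PA : forall s, 0 <= s <= 1 -> 0 < A - 2 * P s).
{ intros s sb; unfold P, d; nra. }
assert (dP : forall s, derivable_pt_lim P s d).
{ intros s; apply is_derive_Reals; unfold P; auto_derive; [trivial | ring]. }
(* [sg] is the sign of [d], and [s0] the end of the unit interval at which
   the denominator first vanishes *)
assert (choice : exists sg s0, (sg = 1 \/ sg = -1) /\ 0 < sg * d /\
  (s0 = 0 \/ s0 = 1) /\
  forall s, 0 <= s <= 1 -> 0 <= sg * ((P s0 - c) ^ 2 - (P s - c) ^ 2)).
{ destruct dir as [up | [down sub]].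
  - assert (convex : forall s, (P s - c) ^ 2 =
      (1 - s) * (p0 - c) ^ 2 + s * (pe - c) ^ 2 - s * (1 - s) * d ^ 2)
      by (intros s; unfold P, d; ring).
    assert (chord : forall s, 0 <= s <= 1 -> 0 <= s * (1 - s) * d ^ 2).
    { intros s sb; apply Rmult_le_pos; [nra | apply pow2_ge_0]. }
    exists 1; destruct (Rle_lt_dec ((p0 - c) ^ 2) ((pe - c) ^ 2)) as [le | lt].
    + exists 1; repeat split; [lra | unfold d; lra | lra |].
      intros s sb; rewrite convex, (convex s); pose proof (chord s sb); nra.
    + exists 0; repeat split; [lra | unfold d; lra | lra |].
      intros s sb; rewrite convex, (convex s); pose proof (chord s sb); nra.
  - exists (-1), 0; repeat split; [lra | unfold d; lra | lra |].
    intros s sb.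
    replace (-1 * ((P 0 - c) ^ 2 - (P s - c) ^ 2)) with
      ((- d * s) * (2 * (c - p0) + - d * s)) by (unfold P; ring).
    assert (0 <= - d * s) by (unfold d; nra).
    apply Rmult_le_pos; lra. }
destruct choice as [sg [s0 [sg1 [sgd [s01 psi0]]]]].
set (L := Rabs d * (2 * (Rabs (p0 - c) + Rabs (pe - c))) + 1).
assert (L0 : 0 < L).
{ pose proof (Rabs_pos d); pose proof (Rabs_pos (p0 - c)).
  pose proof (Rabs_pos (pe - c)); unfold L; nra. }
assert (near : forall s, 0 <= s <= 1 ->
  Rabs (P s - c) <= Rabs (p0 - c) + Rabs (pe - c)).
{ intros s sb.
  replace (P s - c) with ((1 - s) * (p0 - c) + s * (pe - c))
    by (unfold P, d; ring).
  eapply Rle_trans; [apply Rabs_triang|].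
  rewrite !Rabs_mult, !(Rabs_pos_eq s), !(Rabs_pos_eq (1 - s)) by lra.
  pose proof (Rabs_pos (p0 - c)); pose proof (Rabs_pos (pe - c)); nra. }
assert (s0b : 0 <= s0 <= 1) by lra.
destruct (exists_unit_integral (fun s => sg * d * (A - 2 * P s) / a)
  (fun s => sg * ((P s0 - c) ^ 2 - (P s - c) ^ 2)) s0 L) as [mu [mu0 time]];
  trivial.
{ intros s _; apply continuity_pt_filterlim.
  apply (ex_derive_continuous (fun s => sg * d * (A - 2 * P s) / a)).
  unfold P; auto_derive; trivial. }
{ intros s sb; apply Rdiv_lt_0_compat; [|exact a0].
  apply Rmult_lt_0_compat; [exact sgd | now apply PA]. }
{ intros s _; apply continuity_pt_filterlim.
  apply (ex_derive_continuous
    (fun s => sg * ((P s0 - c) ^ 2 - (P s - c) ^ 2))).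
  unfold P; auto_derive; trivial. }
{ intros s sb; split; [now apply psi0|].
  eapply Rle_trans; [apply Rle_abs|].
  replace (sg * ((P s0 - c) ^ 2 - (P s - c) ^ 2)) with
    (- sg * d * ((P s0 - c) + (P s - c)) * (s - s0)) by (unfold P; ring).
  rewrite Rabs_mult; apply Rmult_le_compat_r; [apply Rabs_pos|].
  rewrite 2!Rabs_mult, Rabs_Ropp.
  assert (Rabs sg = 1) as ->
    by (destruct sg1 as [-> | ->]; [apply Rabs_R1 | rewrite Rabs_left; lra]).
  pose proof (Rabs_triang (P s0 - c) (P s - c)).
  pose proof (near s sb); pose proof (near s0 s0b); pose proof (Rabs_pos d).
  unfold L; rewrite Rmult_1_l.
  eapply Rle_trans; [apply Rmult_le_compat_l with
    (r2 := 2 * (Rabs (p0 - c) + Rabs (pe - c))); lra | lra]. }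
set (B := (P s0 - c) ^ 2 + sg * mu).
assert (sg2 : sg * sg = 1) by (destruct sg1 as [-> | ->]; ring).
assert (den : forall s, mu + sg * ((P s0 - c) ^ 2 - (P s - c) ^ 2) =
  sg * (B - (P s - c) ^ 2)).
{ intros s; unfold B; replace mu with (sg * sg * mu) at 1
    by (rewrite sg2; ring); ring. }
set (k := fun s => sg * d * (A - 2 * P s) / a /
  (mu + sg * ((P s0 - c) ^ 2 - (P s - c) ^ 2))).
destruct (unit_time_flow k) as [S [S0 [S1 [Sinc dS]]]]; trivial.
{ intros s sb; apply continuity_pt_filterlim.
  apply (ex_derive_continuous k).
  pose proof (psi0 s sb); unfold k, P in *; auto_derive; lra. }
{ intros s sb; apply Rdiv_lt_0_compat; [|pose proof (psi0 s sb); lra].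
  apply Rdiv_lt_0_compat; [|exact a0].
  apply Rmult_lt_0_compat; [exact sgd | now apply PA]. }
exists B, (fun x => P (S x)); split; [|split; [|split]].
- rewrite S0; unfold P; ring.
- rewrite S1; unfold P, d; ring.
- intros x y xy; fold d; apply Sinc in xy.
  replace (d * (P (S y) - P (S x))) with (d * d * (S y - S x))
    by (unfold P; ring).
  assert (d <> 0) by (intros E; rewrite E in sgd; lra).
  apply Rmult_lt_0_compat; [nra | lra].
- intros x xb.
  assert (Sb : 0 <= S x <= 1).
  { destruct xb as [[xl | <-] [xr | ->]]; try lra.
    apply Sinc in xl, xr; lra. }
  replace (a * (B - (P (S x) - c) ^ 2) / (A - 2 * P (S x))) with
    (/ k (S x) * d).
  + apply (is_derive_comp (V := R_NormedModule)); [|now apply dS].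
    apply is_derive_Reals, dP.
  + pose proof (psi0 (S x) Sb) as pos; pose proof (PA (S x) Sb).
    unfold k; rewrite den.
    assert (nz : sg * (B - (P (S x) - c) ^ 2) <> 0) by (rewrite <- den; lra).
    assert (sg <> 0) by (intros E; rewrite E in sgd; lra).
    assert (d <> 0) by (intros E; rewrite E in sgd; lra).
    assert (B - (P (S x) - c) ^ 2 <> 0)
      by (intros E; apply nz; rewrite E; ring).
    field; repeat split; lra.
Qed.

(** * Functions of the pressure along a profile *)

Lemma D_in_is_derive (f f1 : R -> R) (D : R -> Prop) (x : R) :
  is_derive f x (f1 x) -> D_in f f1 D x.
Proof.
intros df e e0; apply is_derive_Reals in df.
destruct (df e e0) as [alp H]; exists alp; split; [apply cond_pos|].
simpl; unfold Rdist; intros y [[_ yx] lt].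
specialize (H (y - x)); replace (x + (y - x)) with y in H by ring.
apply H; [lra | exact lt].
Qed.

Lemma continue_in_pt (f : R -> R) (D : R -> Prop) (x : R) :
  continuity_pt f x -> continue_in f D x.
Proof.
intros fx e e0; destruct (fx e e0) as [alp [alp0 H]].
exists alp; split; [exact alp0|]; intros y [[_ yx] lt]; apply H.
split; [split; [exact I | now apply not_eq_sym] | exact lt].
Qed.

Section Flow.

Variables (J : R -> Prop) (p G G1 : R -> R).
Hypothesis (pJ : forall x, I01 x -> J (p x)).
Hypothesis (dp : forall x, I01 x -> is_derive p x (G (p x))).
Hypothesis (dG : forall y, J y -> is_derive G y (G1 y)).

Lemma has_derivative_along_flow (H H1 : R -> R) :
  (forall y, J y -> is_derive H y (H1 y)) ->
  has_derivative (fun x => H (p x)) (fun x => H1 (p x) * G (p x)).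
Proof.
intros dH x xI; apply D_in_is_derive; rewrite Rmult_comm.
apply (is_derive_comp (V := R_NormedModule)); auto.
Qed.

Lemma has_second_derivative_along_flow (H H1 H2 : R -> R) :
  (forall y, J y -> is_derive H y (H1 y)) ->
  (forall y, J y -> is_derive H1 y (H2 y)) ->
  has_second_derivative (fun x => H (p x))
    (fun x => (H2 (p x) * G (p x) + H1 (p x) * G1 (p x)) * G (p x)).
Proof.
intros dH dH1; exists (fun x => H1 (p x) * G (p x)).
split; [now apply has_derivative_along_flow|].
apply (has_derivative_along_flow (fun y => H1 y * G y)
  (fun y => H2 y * G y + H1 y * G1 y)).
intros y yJ; apply (is_derive_mult (K := R_AbsRing)); auto.
exact Rmult_comm.
Qed.

Lemma C2_along_flow (H H1 H2 : R -> R) :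
  (forall y, J y -> continuity_pt G1 y) ->
  (forall y, J y -> is_derive H y (H1 y)) ->
  (forall y, J y -> is_derive H1 y (H2 y)) ->
  (forall y, J y -> continuity_pt H2 y) ->
  C2_01 (fun x => H (p x)).
Proof.
intros cG1 dH dH1 cH2.
assert (cont : forall f f1 x, is_derive f x (f1 x : R) -> continuity_pt f x).
{ intros f f1 x df; apply derivable_continuous_pt; exists (f1 x).
  now apply is_derive_Reals. }
eexists; split.
{ exact (has_second_derivative_along_flow H H1 H2 dH dH1). }
intros x xI; apply continue_in_pt.
apply (continuity_pt_comp p
  (fun y => (H2 y * G y + H1 y * G1 y) * G y)).
- apply (cont p (fun x => G (p x))); auto.
- pose proof (pJ x xI) as yJ.
  assert (continuity_pt G (p x)) by (apply (cont G G1); auto).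
  assert (continuity_pt H1 (p x)) by (apply (cont H1 H2); auto).
  repeat first [apply continuity_pt_mult | apply continuity_pt_plus]; auto.
Qed.

End Flow.

(** * Gas states with given mass and momentum fluxes *)

(** The state with mass flux [m], momentum flux [A] and pressure [y]. *)
Definition state_at (m A y : R) : state :=
  State ((A - y) / m) (m ^ 2 / (A - y)) y.

Lemma gas_state_at m A y : 0 < m -> 0 < y < A -> gas_state (state_at m A y).
Proof.
intros m0 yA; split; simpl; [|lra].
apply Rdiv_lt_0_compat; [apply Rmult_lt_0_compat |]; lra.
Qed.

(** Velocity, density, internal energy and Bernoulli function are rational
functions of the pressure, so every derivative in the system follows from
the chain rule along the scalar equation.  The energy equation holds because
[eps e' - m Phi] equals a constant: the derivative of [e] with respect to the
pressure has the factor [A - 2 p], which cancels the denominator of [p']. *)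
Lemma profile_bvp_solution (gamma eps m A B pe : R) (p : R -> R) :
  1 < gamma -> 0 < eps -> 0 < m ->
  (forall x, I01 x -> 0 < p x < A / 2) ->
  (forall x, I01 x -> is_derive p x
     ((gamma + 1) * m / (2 * eps) * (B - (p x - A / (gamma + 1)) ^ 2) /
        (A - 2 * p x))) ->
  p 1 = pe ->
  bvp_solution gamma eps (state_at m A (p 0)) pe (fun x => state_at m A (p x)).
Proof.
intros g1 e0 m0 pb dp p1.
set (a := (gamma + 1) * m / (2 * eps)) in dp.
set (c := A / (gamma + 1)) in dp.
set (J := fun y => 0 < y < A / 2).
set (G := fun y => a * (B - (y - c) ^ 2) / (A - 2 * y)).
set (G1 := fun y => a * (-2 * (y - c)) / (A - 2 * y) +
  2 * a * (B - (y - c) ^ 2) / (A - 2 * y) ^ 2).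
assert (dG : forall y, J y -> is_derive G y (G1 y)).
{ intros y yJ; unfold J in yJ; unfold G, G1; auto_derive; [lra|field; lra]. }
assert (cG1 : forall y, J y -> continuity_pt G1 y).
{ intros y yJ; unfold J in yJ.
  apply continuity_pt_filterlim, (ex_derive_continuous G1).
  unfold G1; auto_derive; split; [lra|split; [|trivial]].
  apply Rgt_not_eq, Rmult_lt_0_compat; lra. }
assert (m2 : 0 < m ^ 2) by (apply pow_lt; lra).
split; [|split; [|split; [|split; [|split; [|split]]]]].
- intros x xI; pose proof (pb x xI); apply gas_state_at; lra.
- split; [|split].
  + apply (C2_along_flow J p G G1 pb dp dG (fun y => (A - y) / m)
      (fun _ => - / m) (fun _ => 0)); trivial.
    * intros y _; auto_derive; [lra | field; lra].
    * intros y _; auto_derive; trivial.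
    * intros y _; apply continuity_pt_const; now intros ? ?.
  + apply (C2_along_flow J p G G1 pb dp dG (fun y => m ^ 2 / (A - y))
      (fun y => m ^ 2 / (A - y) ^ 2) (fun y => 2 * m ^ 2 / (A - y) ^ 3));
      trivial; intros y yJ; unfold J in yJ;
      assert (Ay : 0 < A - y) by lra;
      pose proof (Rmult_lt_0_compat _ _ Ay Ay).
    * auto_derive; [lra | field; lra].
    * auto_derive; [nra | field; lra].
    * apply continuity_pt_filterlim.
      apply (ex_derive_continuous (fun y => 2 * m ^ 2 / (A - y) ^ 3)).
      auto_derive; apply Rgt_not_eq.
      change (0 < (A + - y) ^ 3); apply pow_lt; lra.
  + apply (C2_along_flow J p G G1 pb dp dG (fun y => y)
      (fun _ => 1) (fun _ => 0)); trivial.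
    * intros y _; auto_derive; trivial.
    * intros y _; auto_derive; trivial.
    * intros y _; apply continuity_pt_const; now intros ? ?.
- intros x xI.
  pose proof (has_derivative_along_flow J p G pb dp
    (fun y => dens (state_at m A y) * vel (state_at m A y)) (fun _ => 0)) as D.
  unfold has_derivative, D_in in *; rewrite <- (Rmult_0_l (G (p x))).
  apply D; trivial.
  intros y yJ; unfold J in yJ; simpl; auto_derive; [lra | field; lra].
- intros x xI.
  pose proof (has_derivative_along_flow J p G pb dp
    (fun y => dens (state_at m A y) * vel (state_at m A y) ^ 2 +
              pres (state_at m A y)) (fun _ => 0)) as D.
  unfold has_derivative, D_in in *; rewrite <- (Rmult_0_l (G (p x))).
  apply D; trivial.
  intros y yJ; unfold J in yJ; simpl; auto_derive; [lra | field; lra].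
- set (e1 := fun y => (A - 2 * y) / ((gamma - 1) * m ^ 2)).
  set (e2 := - 2 / ((gamma - 1) * m ^ 2)).
  exists (fun x => (e2 * G (p x) + e1 (p x) * G1 (p x)) * G (p x)).
  split.
  + apply (has_second_derivative_along_flow J p G G1 pb dp dG
      (fun y => internal_energy gamma (state_at m A y)) e1 (fun _ => e2)).
    * intros y yJ; unfold J in yJ; unfold internal_energy, e1; simpl.
      auto_derive.
      { split; [lra|split;[|trivial]].
        apply Rgt_not_eq, Rmult_lt_0_compat; [lra|].
        apply Rinv_0_lt_compat; lra. }
      field; repeat split; lra.
    * intros y _; unfold e1, e2; auto_derive; [trivial|]. field; nra.
  + set (b1 := fun y => - (gamma + 1) * (y - c) / ((gamma - 1) * m)).
    intros x xI.
    pose proof (has_derivative_along_flow J p G pb dp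
      (fun y => dens (state_at m A y) * vel (state_at m A y) *
                bernoulli gamma (state_at m A y)) b1) as D.
    unfold has_derivative, D_in in *.
    replace (eps * ((e2 * G (p x) + e1 (p x) * G1 (p x)) * G (p x)))
      with (b1 (p x) * G (p x)).
    * apply D; trivial.
      intros y yJ; unfold J in yJ; unfold bernoulli, b1, c; simpl.
      auto_derive.
      { repeat split; try lra; apply Rgt_not_eq, Rmult_lt_0_compat; try lra.
        apply Rinv_0_lt_compat; lra. }
      field; repeat split; lra.
    * pose proof (pb x xI); unfold b1, e1, e2, G1, G, a.
      field; repeat split; lra.
- reflexivity.
- exact p1.
Qed.

Lemma mach_compare_one (gamma : R) (U : state) :
  1 < gamma -> gas_state U ->
  (1 < mach gamma U <-> gamma * pres U < dens U * vel U ^ 2) /\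
  (mach gamma U < 1 <-> dens U * vel U ^ 2 < gamma * pres U).
Proof.
intros g1 [r0 p0]; unfold mach, sound_speed.
set (c2 := gamma * pres U / dens U).
assert (c20 : 0 < c2).
{ apply Rdiv_lt_0_compat; [apply Rmult_lt_0_compat|]; lra. }
assert (cr : gamma * pres U = c2 * dens U) by (unfold c2; field; lra).
pose proof (sqrt_lt_R0 c2 c20) as c0.
pose proof (sqrt_sqrt c2 (Rlt_le _ _ c20)) as cc.
revert c0 cc; generalize (sqrt c2); intros c c0 cc.
rewrite cr, <- cc, <- (pow2_abs (vel U)).
generalize (Rabs_pos (vel U)); generalize (Rabs (vel U)).
intros v v0; clear - r0 v0 c0.
assert (E : v = v / c * c) by (field; lra).
assert (M0 : 0 <= v / c)
  by (apply Rmult_le_pos; [lra | left; now apply Rinv_0_lt_compat]).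
revert E M0; generalize (v / c); intros M -> M0.
assert (q0 : 0 < dens U * (c * c)) by (repeat apply Rmult_lt_0_compat; lra).
replace (c * c * dens U) with (dens U * (c * c) * 1) by ring.
replace (dens U * (M * c) ^ 2) with (dens U * (c * c) * (M * M)) by ring.
split; split; intros H.
- apply Rmult_lt_compat_l; [exact q0 | nra].
- apply Rmult_lt_reg_l in H; [nra | exact q0].
- apply Rmult_lt_compat_l; [exact q0 | nra].
- apply Rmult_lt_reg_l in H; [nra | exact q0].
Qed.

(** [rho u ^ 2 = A - y], so the sonic pressure solves [gamma y = A - y]. *)
Lemma mach_state_at (gamma m A y : R) :
  1 < gamma -> 0 < m -> 0 < y < A ->
  (1 < mach gamma (state_at m A y) <-> y < A / (gamma + 1)) /\
  (mach gamma (state_at m A y) < 1 <-> A / (gamma + 1) < y).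
Proof.
intros g1 m0 yA.
destruct (mach_compare_one gamma (state_at m A y)) as [-> ->]; trivial.
{ now apply gas_state_at. }
assert (dens (state_at m A y) * vel (state_at m A y) ^ 2 = A - y) as ->
  by (simpl; field; lra).
change (pres (state_at m A y)) with y.
assert (E : A = A / (gamma + 1) * (gamma + 1)) by (field; lra).
revert E; generalize (A / (gamma + 1)); intros c E.
rewrite E; split; split; intros H; nra.
Qed.

(** With equal mass and momentum fluxes, the Bernoulli function is a
quadratic polynomial in the pressure that is symmetric about the sonic
pressure; two distinct pressures where it agrees have the sonic pressure as
their mean. *)
Lemma rankine_hugoniot_mean_pressure (gamma q0 rho0 p0 q1 rho1 p1 : R) :
  1 < gamma -> 0 < q0 -> 0 < rho0 -> p0 <> p1 ->
  rankine_hugoniot gamma (State q0 rho0 p0) (State q1 rho1 p1) ->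
  gas_state (State q1 rho1 p1) ->
  (p0 + p1) / 2 = (rho0 * q0 ^ 2 + p0) / (gamma + 1).
Proof.
intros g1 q00 r00 ne [mass [mom ber]] [r10 p10]; unfold bernoulli in ber.
simpl in *.
set (A := rho0 * (q0 * (q0 * 1)) + p0) in *.
set (m := rho0 * q0) in *.
assert (m0 : 0 < m) by now apply Rmult_lt_0_compat.
assert (E0 : q0 = (A - p0) / m) by (unfold A, m; field; lra).
assert (q1nz : q1 <> 0) by (intros E; rewrite E in mass; lra).
assert (E1 : q1 = (A - p1) / m).
{ rewrite mom, mass; field; split; [exact q1nz | lra]. }
assert (R0 : p0 / rho0 = p0 * q0 / m) by (unfold m; field; lra).
assert (R1 : p1 / rho1 = p1 * q1 / m)
  by (rewrite mass; field; split; [exact q1nz | lra]).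
rewrite R0, R1, E0, E1 in ber.
(* the two Bernoulli values differ by this product times a nonzero factor *)
assert (F : (p1 - p0) * ((p0 + p1) / 2 - A / (gamma + 1)) = 0).
{ apply (Rmult_eq_reg_l ((gamma + 1) / ((gamma - 1) * m ^ 2))).
  - rewrite Rmult_0_r; apply Rminus_diag_eq in ber.
    rewrite <- ber; field; repeat split; lra.
  - apply Rgt_not_eq, Rdiv_lt_0_compat; [lra|].
    apply Rmult_lt_0_compat; [lra | now apply pow_lt]. }
apply Rmult_integral in F; lra.
Qed.

(** * Supersonic and transonic solutions *)

Lemma strictly_between_of_pos_mult (a b y : R) :
  0 < (b - a) * (y - a) -> 0 < (b - a) * (b - y) -> a < y < b \/ b < y < a.
Proof.
intros l r; destruct (Rtotal_order a b) as [ab | [-> | ba]].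
- left; split; nra.
- lra.
- right; split; nra.
Qed.

Theorem theorem1p2 (gamma q0 rho0 p0 q1 rho1 p1 : R) :
  let U0 := State q0 rho0 p0 in
  let U1 := State q1 rho1 p1 in
  let M0 := sqrt (rho0 * q0 ^ 2 / (gamma * p0)) in
  let pstar := (p0 + p1) / 2 in
  let A := rho0 * q0 ^ 2 + p0 in
  1 < gamma ->
  0 < q0 -> 0 < rho0 -> 0 < p0 ->
  1 < M0 ->
  gas_state U1 -> mach gamma U1 < 1 -> rankine_hugoniot gamma U0 U1 ->
  (1 < gamma < 3 /\ 1 < M0 ^ 2 <= (3 * gamma - 1) / (gamma * (3 - gamma))) \/
  (3 <= gamma /\ 1 < M0) ->
  forall eps : R, 0 < eps ->
    (forall pe : R, 0 < pe < p0 \/ p0 < pe < pstar ->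
       exists U : R -> state,
         bvp_solution gamma eps U0 pe U /\ supersonic gamma U) /\
    (forall pe : R, pstar < pe < p1 \/ p1 < pe < A / 2 ->
       exists U : R -> state,
         bvp_solution gamma eps U0 pe U /\ transonic gamma U).
Proof.
intros U0 U1 M0 pstar A g1 q00 r00 p00 M01 gas1 sub1 RH cond eps e0.
set (m := rho0 * q0).
assert (m0 : 0 < m) by now apply Rmult_lt_0_compat.
assert (M02 : gamma * p0 * M0 ^ 2 = rho0 * q0 ^ 2).
{ unfold M0; rewrite pow2_sqrt; [field; lra|].
  left; apply Rdiv_lt_0_compat; repeat apply Rmult_lt_0_compat; lra. }
clearbody M0.
assert (M0sq : 1 < M0 ^ 2) by nra.
assert (gp : 0 < gamma * p0) by (apply Rmult_lt_0_compat; lra).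
assert (super0 : gamma * p0 < rho0 * q0 ^ 2)
  by (apply (Rmult_lt_compat_l (gamma * p0)) in M0sq; lra).
assert (sub1' : rho1 * q1 ^ 2 < gamma * p1)
  by (now apply (mach_compare_one gamma U1) in sub1).
assert (mom : A = rho1 * q1 ^ 2 + p1) by exact (proj1 (proj2 RH)).
assert (ne : p0 <> p1) by (intros E; rewrite <- E in *; unfold A in mom; lra).
assert (star : pstar = A / (gamma + 1))
  by (now apply (rankine_hugoniot_mean_pressure gamma q0 rho0 p0 q1 rho1 p1)).
assert (starA : (gamma + 1) * pstar = A) by (rewrite star; field; lra).
assert (p0star : p0 < pstar) by (unfold A in starA; nra).
assert (starp1 : pstar < p1) by (unfold pstar in *; lra).
assert (p1A : p1 <= A / 2).
{ assert (AE : A = p0 * (gamma * M0 ^ 2 + 1)) by (unfold A; lra).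
  (* as [p1 = 2 A / (gamma + 1) - p0], the claim [p1 <= A / 2] means
     (3 - gamma) A <= 2 (gamma + 1) p0, here divided by [p0] *)
  assert (le : (3 - gamma) * (gamma * M0 ^ 2 + 1) <= 2 * (gamma + 1)).
  { destruct cond as [[g3 [_ Mle]] | [g3 _]].
    - assert (pos : 0 < gamma * (3 - gamma)) by (apply Rmult_lt_0_compat; lra).
      apply (Rmult_le_compat_r (gamma * (3 - gamma))) in Mle; [|lra].
      replace ((3 * gamma - 1) / (gamma * (3 - gamma)) * (gamma * (3 - gamma)))
        with (3 * gamma - 1) in Mle by (field; lra).
      lra.
    - assert (0 <= gamma * M0 ^ 2 + 1) by (pose proof (pow2_ge_0 M0); nra).
      assert (0 <= (gamma - 3) * (gamma * M0 ^ 2 + 1))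
        by (apply Rmult_le_pos; lra).
      lra. }
  apply (Rmult_le_compat_l p0) in le; [|lra].
  apply (Rmult_le_reg_l (gamma + 1)); [lra|].
  unfold pstar in starA; rewrite AE in *; lra. }
assert (starA2 : pstar < A / 2) by nra.
assert (U0E : U0 = state_at m A p0).
{ unfold U0, state_at, m, A; f_equal; field; lra. }
assert (profile : forall pe, 0 < pe < A / 2 -> p0 <> pe ->
  exists p : R -> R, p 0 = p0 /\ p 1 = pe /\
    (forall x y, x < y -> 0 < (pe - p0) * (p y - p x)) /\
    (forall x, I01 x -> 0 < p x < A / 2 /\ continuity_pt p x) /\
    bvp_solution gamma eps U0 pe (fun x => state_at m A (p x))).
{ intros pe peb nee.
  destruct (exists_pressure_profile A ((gamma + 1) * m / (2 * eps))
    (A / (gamma + 1)) p0 pe) as [B [p [P0 [P1 [mono dp]]]]]; try lra.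
  { apply Rdiv_lt_0_compat; [apply Rmult_lt_0_compat |]; lra. }
  assert (pb : forall x, I01 x -> 0 < p x < A / 2).
  { intros x [[xl | <-] xr]; [destruct xr as [xr | ->] |]; try lra.
    apply mono in xl, xr; rewrite P0 in xl; rewrite P1 in xr.
    destruct (strictly_between_of_pos_mult _ _ _ xl xr); lra. }
  exists p; split; [exact P0|split; [exact P1|split; [exact mono|split]]].
  - intros x xI; split; [now apply pb|].
    apply derivable_continuous_pt; eexists; apply is_derive_Reals, dp, xI.
  - rewrite U0E, <- P0; now apply profile_bvp_solution with (B := B). }
split; intros pe peb.
- destruct (profile pe) as [p [P0 [P1 [mono [pb sol]]]]];
    [lra | intros E; lra |].
  exists (fun x => state_at m A (p x)); split; [exact sol|].
  intros x xI; destruct (pb x xI) as [b _].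
  apply mach_state_at; try lra; rewrite <- star.
  destruct xI as [[xl | <-] xr]; [destruct xr as [xr | ->] |]; try lra.
  apply mono in xl, xr; rewrite P0 in xl; rewrite P1 in xr.
  destruct (strictly_between_of_pos_mult _ _ _ xl xr); lra.
- destruct (profile pe) as [p [P0 [P1 [mono [pb sol]]]]];
    [lra | intros E; lra |].
  exists (fun x => state_at m A (p x)); split; [exact sol|].
  assert (inc : forall x y, x < y -> p x < p y).
  { intros x y xy; apply mono in xy; nra. }
  destruct (IVT_interv (fun x => p x - pstar) 0 1) as [xh [xhb xhE]]; try lra.
  { intros x xI; apply continuity_pt_minus; [now apply pb|].
    apply continuity_pt_const; now intros ? ?. }
  exists xh; split.
  { destruct xhb as [[xl | <-] [xr | ->]]; lra. }
  intros x xI; destruct (pb x xI) as [b _].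
  split; intros lt; apply inc in lt; apply mach_state_at;
    try lra; rewrite <- star; lra.
Qed.
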